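(* Let $r\ge1$ and $n\ge1$ be integers and let $q,z$ be indeterminates. Let $$L_q(-n,1,r)(z)=\sum_{\substack{m\ge1\\ m\equiv 1\ (\mathrm{mod}\ r)}}[m]_q^n\,z^m .$$ Then $$L_q(-n,1,r)(z)=z\,\frac{G_{r,n}(z^r,q)}{(z^r;q^r)_{n+1}},$$ where $G_{r,n}(Z,q)=\sum_{\gamma\in G(r,n)}Z^{\mathrm{des}_G(\gamma)}q^{\mathrm{fmaj}(\gamma)}$ is the generating polynomial of the group $G(r,n)$ of $r$-coloured permutations.
   Context: Notation: $[m]_q=\frac{1-q^m}{1-q}$, and $(a;q)_n=(1-a)(1-aq)\cdots(1-aq^{n-1})$. $L_q(-n,c,r)(z)$ is the value on the power series $f(z)=z$ of the operator $L_q(s,c,r)=\sum_{m\ge1,\ m\equiv c\,(\mathrm{mod}\ r)}\frac{1}{[m]_q^s}F_m$ at $s=-n$, where $F_m(f)(q,z)=f(q^m,z^m)$ acts on formal power series in $z$ without constant term over $\mathbb{Q}(q)$; for $c=1$ this gives the displayed series. The identity is one of formal power series in $z$ over $\mathbb{Q}(q)$. Coloured permutations: for $r,n\ge1$, $G(r,n)=\{(c_1,\dots,c_n;\sigma): c_i\in\{0,\dots,r-1\},\ \sigma\in S_n\}$, and an element is written $\gamma=[\gamma(1),\dots,\gamma(n)]=[\sigma(1)^{c_1},\dots,\sigma(n)^{c_n}]$. The possible values are totally ordered, together with the symbol $0$, by $$n^{r-1}<\dots<n^1<\dots<1^{r-1}<\dots<1^1<0<1^0<\dots<n^0 .$$ Set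 $\gamma(0):=0$, $\mathrm{Des}_G(\gamma)=\{i\in\{0,\dots,n-1\}:\gamma(i)>\gamma(i+1)\}$, $\mathrm{des}_G(\gamma)=|\mathrm{Des}_G(\gamma)|$, $\mathrm{maj}(\gamma)=\sum_{i\in\mathrm{Des}_G(\gamma)}i$, $\mathrm{col}(\gamma)=\sum_{i=1}^n c_i$, and $\mathrm{fmaj}(\gamma)=r\cdot\mathrm{maj}(\gamma)+\mathrm{col}(\gamma)$. *)

(* Defs.v *)
From HB Require Import structures.
From mathcomp Require Import all_boot all_order all_fingroup all_algebra.
From mathcomp Require Import generic_quotient fraction boolp zify.

Set Implicit Arguments.
Unset Strict Implicit.
Unset Printing Implicit Defensive.

Import GRing.Theory.
Local Open Scope ring_scope.

(** * Formal power series [R[[z]]] *)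

Record fps (R : Type) := FPS { fpscoef :> nat -> R }.

HB.instance Definition _ (R : Type) := gen_eqMixin (fps R).
HB.instance Definition _ (R : Type) := gen_choiceMixin (fps R).

Lemma fpsP (R : Type) (f g : fps R) : (forall k, f k = g k) -> f = g.
Proof. by case: f g => [f] [g] /= fg; congr FPS; apply/funext. Qed.

Section FpsZmod.
Variable R : zmodType.
Implicit Types f g h : fps R.

Definition fps_zero : fps R := FPS (fun=> 0).
Definition fps_add f g := FPS (fun k => f k + g k).
Definition fps_opp f := FPS (fun k => - f k).

Fact fps_addA : associative fps_add.
Proof. by move=> f g h; apply: fpsP => k /=; rewrite addrA. Qed.
Fact fps_addC : commutative fps_add.
Proof. by move=> f g; apply: fpsP => k /=; rewrite addrC. Qed.
Fact fps_add0 : left_id fps_zero fps_add.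
Proof. by move=> f; apply: fpsP => k /=; rewrite add0r. Qed.
Fact fps_addN : left_inverse fps_zero fps_opp fps_add.
Proof. by move=> f; apply: fpsP => k /=; rewrite addNr. Qed.

HB.instance Definition _ :=
  GRing.isZmodule.Build (fps R) fps_addA fps_addC fps_add0 fps_addN.

Lemma fps_coef0 k : (0 : fps R) k = 0. Proof. by []. Qed.
Lemma fps_coefD f g k : (f + g) k = f k + g k. Proof. by []. Qed.
Lemma fps_coefN f k : (- f) k = - f k. Proof. by []. Qed.
Lemma fps_coefB f g k : (f - g) k = f k - g k. Proof. by []. Qed.

Lemma fps_coef_sum (I : Type) (s : seq I) (P : pred I) (F : I -> fps R) k :
  (\sum_(i <- s | P i) F i) k = \sum_(i <- s | P i) F i k.
Proof. by apply: (big_morph (fun f : fps R => f k)). Qed.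

End FpsZmod.

Section FpsRing.
Variable R : comNzRingType.
Implicit Types f g h : fps R.

Definition fpsC (c : R) : fps R := FPS (fun k => if k == 0%N then c else 0).
Definition fpsX : fps R := FPS (fun k => (k == 1%N)%:R).

Definition fps_mul f g : fps R :=
  FPS (fun k => \sum_(i < k.+1) f i * g (k - i)%N).

Let trunc m f : {poly R} := \poly_(i < m) f i.

Let coef_mul_trunc m f g k :
  (k < m)%N -> fps_mul f g k = (trunc m f * trunc m g)`_k.
Proof.
move=> km; rewrite coefM /=; apply: eq_bigr => i _; rewrite !coef_poly.
have ik : (i <= k)%N by rewrite -ltnS.
by rewrite (leq_ltn_trans ik km) (leq_ltn_trans (leq_subr _ _) km).
Qed.

Fact fps_mulA : associative fps_mul.
Proof.
move=> f g h; apply: fpsP => k.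
transitivity ((trunc k.+1 f * (trunc k.+1 g * trunc k.+1 h))`_k).
  rewrite [RHS]coefM /=; apply: eq_bigr => i _; rewrite coef_poly ltn_ord.
  by rewrite -coef_mul_trunc // ltnS leq_subr.
rewrite mulrA [LHS]coefM /=; apply: eq_bigr => i _.
by rewrite [(trunc _ h)`_ _]coef_poly ltnS leq_subr -coef_mul_trunc.
Qed.
Fact fps_mulC : commutative fps_mul.
Proof.
by move=> f g; apply: fpsP => k; rewrite !(coef_mul_trunc _ _ (leqnn _)) mulrC.
Qed.
Fact fps_mul1 : left_id (fpsC 1) fps_mul.
Proof.
move=> f; apply: fpsP => k /=.
by rewrite big_ord_recl big1 ?addr0 ?subn0 /= ?mul1r // => i _; rewrite mul0r.
Qed.
Fact fps_mulDl : left_distributive fps_mul (@fps_add R).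
Proof.
move=> f g h; apply: fpsP => k /=; rewrite -big_split.
by apply: eq_bigr => i _; rewrite mulrDl.
Qed.
Fact fps_oner_neq0 : fpsC 1 != 0.
Proof.
apply/eqP => /(congr1 (fun f : fps R => f 0%N)) /= /eqP.
by rewrite oner_eq0.
Qed.

HB.instance Definition _ := GRing.Zmodule_isComNzRing.Build (fps R)
  fps_mulA fps_mulC fps_mul1 fps_mulDl fps_oner_neq0.

Lemma fps_coef1 k : (1 : fps R) k = (k == 0%N)%:R.
Proof. by rewrite /= ; case: eqP. Qed.
Lemma fps_coefM f g k : (f * g) k = \sum_(i < k.+1) f i * g (k - i)%N.
Proof. by []. Qed.

Fact fpsC_is_zmod_morphism : zmod_morphism fpsC.
Proof.
by move=> a b; apply: fpsP => k; rewrite fps_coefB /=; case: eqP; rewrite ?subr0.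
Qed.
Fact fpsC_is_monoid_morphism : monoid_morphism fpsC.
Proof.
split=> // a b; apply: fpsP => k; rewrite fps_coefM big_ord_recl big1 /=.
  by rewrite subn0 addr0; case: eqP; rewrite ?mulr0.
by move=> i _; rewrite mul0r.
Qed.
HB.instance Definition _ :=
  GRing.isZmodMorphism.Build R (fps R) fpsC fpsC_is_zmod_morphism.
HB.instance Definition _ :=
  GRing.isMonoidMorphism.Build R (fps R) fpsC fpsC_is_monoid_morphism.

End FpsRing.

Arguments fpsX {R}.

Section FpsUnitRing.
Variable R : comUnitRingType.
Implicit Types f g : fps R.

Fixpoint fps_inv_seq f (m : nat) : seq R :=
  if m is k.+1 then
    let s := fps_inv_seq f k in
    rcons s ((f 0%N)^-1 * ((k == 0%N)%:R - \sum_(i < k) s`_i * f (k - i)%N))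
  else [::].

Definition fps_unit : {pred fps R} := fun f => f 0%N \is a GRing.unit.
Definition fps_inv f : fps R :=
  if fps_unit f then FPS (fun k => (fps_inv_seq f k.+1)`_k) else f.

Let size_inv_seq f m : size (fps_inv_seq f m) = m.
Proof. by elim: m => //= m IHm; rewrite size_rcons IHm. Qed.

Let nth_inv_seq f m i :
  (i < m)%N -> (fps_inv_seq f m)`_i = (fps_inv_seq f i.+1)`_i.
Proof.
elim: m => // m IHm; rewrite ltnS leq_eqVlt => /predU1P[-> //|im].
by rewrite [LHS]/= nth_rcons size_inv_seq im IHm.
Qed.

Fact fps_mulVx : {in fps_unit, left_inverse 1 fps_inv *%R}.
Proof.
move=> f uf; have {}uf : fps_unit f := uf; apply: fpsP => k.
rewrite fps_coefM fps_coef1 /fps_inv uf big_ord_recr /= subnn.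
rewrite nth_rcons size_inv_seq ltnn eqxx mulrC mulrA divrr // mul1r.
rewrite (eq_bigr (fun i : 'I_k => (fps_inv_seq f k)`_i * f (k - i)%N)).
  by rewrite addrC subrK.
by move=> i _; rewrite (nth_inv_seq _ (ltn_ord i)).
Qed.
Fact fps_unitPl f g : g * f = 1 -> fps_unit f.
Proof.
move=> /(congr1 (fun h : fps R => h 0%N)); rewrite fps_coefM big_ord1 /= => gf.
by rewrite /fps_unit; apply/unitrPr; exists (g 0%N); rewrite mulrC.
Qed.
Fact fps_invr_out : {in [predC fps_unit], fps_inv =1 id}.
Proof.
by move=> f uf; have {}uf : ~~ fps_unit f := uf; rewrite /fps_inv (negbTE uf).
Qed.

HB.instance Definition _ := GRing.ComNzRing_hasMulInverse.Build (fps R)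
  fps_mulVx fps_unitPl fps_invr_out.

Lemma fps_unitE f : (f \is a GRing.unit) = (f 0%N \is a GRing.unit).
Proof. by []. Qed.

End FpsUnitRing.

(** * The field [Q(q)] and the operators [F_m] and [L_q(s, c, r)] *)

Definition Qq : fieldType := {fraction {poly rat}}.
Definition qvar : Qq := FracField.tofrac 'X.

(* The substitution q := q^m in Q(q), for m >= 1; [substqE] shows that it does
   not depend on the representative chosen by [repr]. *)
Definition substq (m : nat) (x : Qq) : Qq :=
  FracField.tofrac (\n_(repr x) \Po 'X^m) /
  FracField.tofrac (\d_(repr x) \Po 'X^m).

Lemma comp_polyXn_neq0 (m : nat) (p : {poly rat}) :
  (0 < m)%N -> p != 0 -> p \Po 'X^m != 0.
Proof.
by move=> m0 p0; rewrite comp_poly_eq0 // size_polyXn ltnS.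
Qed.

Lemma frac_repr (R : idomainType) (x : {fraction R}) :
  x = FracField.tofrac \n_(repr x) / FracField.tofrac \d_(repr x).
Proof.
have dx : FracField.tofrac \d_(repr x) != 0 by rewrite tofrac_eq0 denom_ratioP.
apply: (canRL (mulfK dx)); rewrite -[in LHS](reprK x) !piE.
apply/eqmodP; rewrite /= FracField.equivfE /FracField.mulf.
rewrite reprK !numden_Ratio ?mulf_neq0 ?oner_neq0 ?denom_ratioP //.
by rewrite !mulr1 mulrC.
Qed.

Lemma substqE (m : nat) (a b : {poly rat}) : (0 < m)%N -> b != 0 ->
  substq m (FracField.tofrac a / FracField.tofrac b) =
  FracField.tofrac (a \Po 'X^m) / FracField.tofrac (b \Po 'X^m).
Proof.
move=> m0 b0; rewrite /substq.
pose x : {fraction {poly rat}} := FracField.tofrac a / FracField.tofrac b.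
rewrite -/x.
have dx := denom_ratioP (repr x).
have := frac_repr x; rewrite {1}/x => /eqP.
rewrite eqr_div ?tofrac_eq0 // -!tofracM tofrac_eq => /eqP abx.
apply/eqP; rewrite eqr_div ?tofrac_eq0 ?comp_polyXn_neq0 //.
by rewrite -!tofracM tofrac_eq -!comp_polyM abx.
Qed.

Definition qint (m : nat) : Qq := (1 - qvar ^+ m) / (1 - qvar).

(* F_m(f)(q, z) = f(q^m, z^m), for m >= 1. *)
Definition Fop (m : nat) (f : fps Qq) : fps Qq :=
  FPS (fun k => if (m %| k)%N then substq m (f (k %/ m)%N) else 0).

(* The infinite sum is coefficientwise: when f has no constant term, F_m(f) is
   a multiple of z^m, so only the terms with m <= k contribute to z^k. *)
Definition Lq (s : int) (c r : nat) (f : fps Qq) : fps Qq :=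
  FPS (fun k => \sum_(1 <= m < k.+1 | m == c %[mod r])
                   (qint m ^ s)^-1 * Fop m f k).

(* (a; x)_n *)
Definition qpoch (A : comNzRingType) (a x : A) (n : nat) : A :=
  \prod_(i < n) (1 - a * x ^+ i).

(** * Coloured permutations *)

Definition colperm (r n : nat) : finType := ({ffun 'I_n -> 'I_r} * 'S_n)%type.

(* [Some (j, c)] is the coloured letter (j+1)^c and [None] is the symbol 0. *)
Definition cletter (r n : nat) := option ('I_n * 'I_r).

(* n^(r-1) < ... < n^1 < ... < 1^(r-1) < ... < 1^1 < 0 < 1^0 < ... < n^0 *)
Definition clt (r n : nat) (x y : cletter r n) : bool :=
  match x, y with
  | None, None => false
  | None, Some (_, d) => d == 0%N :> nat
  | Some (_, c), None => (0 < c)%N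
  | Some (j, c), Some (k, d) =>
    if c == 0%N :> nat then (d == 0%N :> nat) && (j < k)%N
    else (d == 0%N :> nat) || (k < j)%N || ((k == j) && (d < c)%N)
  end.

Lemma clt_irr (r n : nat) : irreflexive (@clt r n).
Proof. by case=> [[j c]|] //=; rewrite !ltnn eqxx /= andbF; case: eqP. Qed.

Lemma clt_trans (r n : nat) : transitive (@clt r n).
Proof.
move=> [[k d]|] [[j c]|] [[l e]|] //=; rewrite -?val_eqE /=;
  by repeat (case: ifPn => ?); lia.
Qed.

Lemma clt_total (r n : nat) (x y : cletter r n) :
  x != y -> clt x y || clt y x.
Proof.
case: x y => [[j c]|] [[k d]|] //=; last by case: ltngtP.
- rewrite (inj_eq Some_inj) xpair_eqE -!val_eqE /=.
  by repeat (case: ifPn => ?); lia.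
- by case: ltngtP.
Qed.

Section Stats.
Variables r n : nat.
Implicit Type g : colperm r n.

(* gamma(i) for 0 <= i <= n: gamma(0) = 0, and the position i.+1 is
   [lift ord0 i] with i : 'I_n. *)
Definition cval g (i : 'I_n.+1) : cletter r n :=
  omap (fun k => (g.2 k, g.1 k)) (unlift ord0 i).

Definition DesG g : {set 'I_n} :=
  [set i : 'I_n | clt (cval g (lift ord0 i)) (cval g (widen_ord (leqnSn n) i))].

Definition desG g : nat := #|DesG g|.
Definition majG g : nat := (\sum_(i in DesG g) i)%N.
Definition colG g : nat := (\sum_(i < n) g.1 i)%N.
Definition fmaj g : nat := (r * majG g + colG g)%N.

End Stats.

Definition Gpoly (A : comNzRingType) (r n : nat) (Z x : A) : A :=
  \sum_(g : colperm r n) Z ^+ desG g * x ^+ fmaj g.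

(* Main.v *)
(** Since [rk+1]_q is the sum of q^v for 0 <= v <= rk, the coefficient of Z^k in
    the sum of the [rk+1]_q^n Z^k enumerates the functions f : [n] -> {0..rk} by
    q^(sum of f).  Write f_j = r a_j + c_j with 0 <= c_j < r, and list the j by
    decreasing a_j, breaking ties by the increasing order of the coloured
    letters j^(c_j).  This attaches to f a unique coloured permutation gamma
    and a chain k = s_0 >= s_1 >= ... >= s_n >= 0, where s_i = a_(sigma(i)),
    which is strict at every descent of gamma.  (The condition at i = 0 says
    exactly f_j <= rk.)  For fixed gamma the chains, counted with weight
    Z^(s_0) q^(r (s_1 + ... + s_n)), have generating function
    Z^des q^(r maj) / (Z; q^r)_(n+1). *)
From HB Require Import structures.
Require Import Defs.
From mathcomp Require Import all_boot all_order all_fingroup all_algebra.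
From mathcomp Require Import fraction zify.
Import GRing.Theory.
Local Open Scope ring_scope.

Set Implicit Arguments.
Unset Strict Implicit.
Unset Printing Implicit Defensive.

(** * Coefficients of products, and the substitution z := q z *)

Section FpsCoef.
Variable R : comNzRingType.
Implicit Types f g : fps R.

Lemma fps_coefCM c f k : (fpsC c * f) k = c * f k.
Proof.
rewrite fps_coefM big_ord_recl /= subn0 big1 ?addr0 // => i _.
by rewrite mul0r.
Qed.

Lemma fps_coefXM f k : (fpsX * f) k = if k is j.+1 then f j else 0.
Proof.
rewrite fps_coefM; case: k => [|k]; first by rewrite big_ord1 /= mul0r.
rewrite 2!big_ord_recl /= mul0r add0r mul1r big1 ?addr0 ?subSS ?subn0 //.
by move=> i _; rewrite mul0r.
Qed.

Lemma fps_coefXnM f m k :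
  (fpsX ^+ m * f) k = if (m <= k)%N then f (k - m)%N else 0.
Proof.
elim: m f k => [|m IHm] f k; first by rewrite expr0 mul1r subn0.
by rewrite exprS -mulrA fps_coefXM; case: k => [|k] //; rewrite IHm subSS.
Qed.

Variable q : R.

(** The substitution z := q z. Being a ring morphism, it carries a whole product identity for
    shorter chains over at once. *)
Definition fps_scale f : fps R := FPS (fun k => q ^+ k * f k).

Fact fps_scale_is_zmod_morphism : zmod_morphism fps_scale.
Proof. by move=> f g; apply: fpsP => k; rewrite /= mulrBr. Qed.

Fact fps_scale_is_monoid_morphism : monoid_morphism fps_scale.
Proof.
split=> [|f g]; apply: fpsP => k.
  by rewrite /= ; case: k => [|k] /=; rewrite ?mulr1 ?mulr0.
rewrite fps_coefM /= mulr_sumr; apply: eq_bigr => i _ /=.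
by rewrite mulrACA -exprD subnKC // -ltnS.
Qed.

HB.instance Definition _ := GRing.isZmodMorphism.Build (fps R) (fps R)
  fps_scale fps_scale_is_zmod_morphism.
HB.instance Definition _ := GRing.isMonoidMorphism.Build (fps R) (fps R)
  fps_scale fps_scale_is_monoid_morphism.

Lemma fps_scaleC c : fps_scale (fpsC c) = fpsC c.
Proof. by apply: fpsP => -[|k] /=; rewrite ?expr0 ?mul1r ?mulr0. Qed.

Lemma fps_scaleX : fps_scale fpsX = fpsC q * fpsX.
Proof.
by apply: fpsP => k; rewrite fps_coefCM /=; case: k => [|[|k]] /=; rewrite ?mulr0.
Qed.

End FpsCoef.

(* The family t = s_0, s_1, ..., s_n, with the indexing of [cval]. *)
Definition ext (n : nat) (T : Type) (t : T) (s : 'I_n -> T) (i : 'I_n.+1) : T :=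
  oapp s t (unlift ord0 i).

Lemma ext_lift n T (t : T) (s : 'I_n -> T) i : ext t s (lift ord0 i) = s i.
Proof. by rewrite /ext liftK. Qed.

Lemma ext_ord0 n T (t : T) (s : 'I_n -> T) : ext t s ord0 = t.
Proof. by rewrite /ext unlift_none. Qed.

Lemma widen_lift0 n (i : 'I_n) :
  widen_ord (leqnSn n.+1) (lift ord0 i) = lift ord0 (widen_ord (leqnSn n) i).
Proof. exact: val_inj. Qed.

Lemma widen_ord0 n : widen_ord (leqnSn n.+1) ord0 = ord0.
Proof. exact: val_inj. Qed.

Lemma forall_ord_recl n (P : pred 'I_n.+1) :
  [forall i, P i] = P ord0 && [forall i : 'I_n, P (lift ord0 i)].
Proof.
apply/forallP/andP=> [H|[H0 /forallP H] i]; first by split=> //; apply/forallP.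
by case: (unliftP ord0 i) => [j ->|->].
Qed.

Lemma sum_ffun_recl (R : nmodType) n (T : finType) (F : {ffun 'I_n.+1 -> T} -> R) :
  \sum_s F s = \sum_t \sum_(s : {ffun 'I_n -> T}) F [ffun i => ext t s i].
Proof.
rewrite pair_bigA /=; apply: reindex.
exists (fun s : {ffun 'I_n.+1 -> T} => (s ord0, [ffun i => s (lift ord0 i)])).
  move=> [t s] _ /=; congr pair; first by rewrite ffunE ext_ord0.
  by apply/ffunP => i; rewrite !ffunE ext_lift.
move=> s _ /=; apply/ffunP => i; rewrite ffunE.
by case: (unliftP ord0 i) => [j ->|->]; rewrite ?ext_lift ?ext_ord0 ?ffunE.
Qed.

(** * Generating functions of chains with prescribed strict steps *)

Section Chains.
Variables (R : comNzRingType) (q : R) (r : nat).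

(** Here [k] is s_0 and the flags [d] mark the steps forced to be strict; the bound [K] makes the
    families [s] a finite type. *)
Definition chain K n (d : 'I_n -> bool) (k : 'I_K) (s : 'I_n -> 'I_K) :=
  [forall i : 'I_n, (s i + d i <= ext k s (widen_ord (leqnSn n) i))%N].

(** The weighted count of chains with s_0 = k, by recursion on s_1 = [j]. The truncated subtraction
    empties the sum when k = 0 and the first step is strict. *)
Fixpoint chain_gf n : ('I_n -> bool) -> nat -> R :=
  match n return ('I_n -> bool) -> nat -> R with
  | 0 => fun _ _ => 1
  | n'.+1 => fun d k => \sum_(j < k.+1 - d ord0)
                 (q ^+ r) ^+ j * chain_gf (fun i => d (lift ord0 i)) j
  end.

Lemma chain_gfE K n (d : 'I_n -> bool) (k : 'I_K) :
  \sum_(s : {ffun 'I_n -> 'I_K} | chain d k s) (q ^+ r) ^+ (\sum_i s i)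
  = chain_gf d k.
Proof.
elim: n => [|n IHn] in d k *.
  rewrite (big_pred1 [ffun i => k]) => [|s]; first by rewrite big_ord0.
  rewrite /=; have -> : s == [ffun=> k] by apply/eqP/ffunP => -[].
  by apply/forallP => -[].
rewrite big_mkcond sum_ffun_recl /=.
transitivity (\sum_(j : 'I_K | (j < k.+1 - d ord0)%N)
   (q ^+ r) ^+ j * chain_gf (fun i => d (lift ord0 i)) j).
  rewrite [RHS]big_mkcond; apply: eq_bigr => j _.
  have E s : chain d k [ffun i => ext j s i] =
      (j < k.+1 - d ord0)%N && chain (fun i => d (lift ord0 i)) j s.
    rewrite /chain forall_ord_recl ffunE ext_ord0 widen_ord0 ext_ord0; congr andb.
      by lia.
    apply: eq_forallb => i.
    by rewrite ffunE ext_lift widen_lift0 ext_lift ffunE.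
  case: ifP => jk; last by rewrite big1 // => s _; rewrite E jk.
  rewrite -IHn mulr_sumr [RHS]big_mkcond; apply: eq_bigr => s _.
  rewrite E jk /=; case: ifP => // _; rewrite big_ord_recl ffunE ext_ord0 exprD.
  by congr (_ * _ ^+ _); apply: eq_bigr => i _; rewrite ffunE ext_lift.
(* Since k < K, every admissible value of s_1 already lies in ['I_K]. *)
rewrite (big_ord_widen_cond K xpredT
  (fun j => (q ^+ r) ^+ j * chain_gf (fun i => d (lift ord0 i)) j)) //.
by have := ltn_ord k; lia.
Qed.

Hypothesis r_gt0 : (0 < r)%N.

(* The series of u in the variable Z = z^r. *)
Definition dilate (u : nat -> R) : fps R :=
  FPS (fun m => if (r %| m)%N then u (m %/ r)%N else 0).

(* Rescaling z to q z turns Z = z^r into q^r Z, which accounts for the weight of s_1. *)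
Lemma dilate_chain_recl n (d : 'I_n.+1 -> bool) :
  (1 - fpsX ^+ r) * dilate (chain_gf d) =
  (fpsX ^+ r) ^+ d ord0 *
    fps_scale q (dilate (chain_gf (fun i => d (lift ord0 i)))).
Proof.
apply: fpsP => m; rewrite mulrBl mul1r fps_coefB fps_coefXnM -exprM fps_coefXnM.
rewrite [dilate]lock /= -lock; set e := fun i => d (lift ord0 i).
(* All shifts are by multiples of r, so both sides vanish at exponents not divisible by r. *)
have [/dvdnP[k ->]|rm] := boolP (r %| m)%N; last first.
  rewrite /= (negbTE rm); case: leqP => h1; first rewrite dvdn_subl // (negbTE rm);
    case: leqP => h2; rewrite ?subr0 //.
    by rewrite dvdn_subl ?dvdn_mulr // (negbTE rm) mulr0.
  by rewrite dvdn_subl ?dvdn_mulr // (negbTE rm) mulr0.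
rewrite /= dvdn_mull // mulnK //.
have -> : (k * r - r = k.-1 * r)%N by case: k => //= k; rewrite mulSn addKn.
have -> : (k * r - r * d ord0 = (k - d ord0) * r)%N by rewrite mulnBl [(r * _)%N]mulnC.
rewrite !dvdn_mull // !mulnK // [(_ * d ord0)%N]mulnC leq_pmul2r //.
rewrite -[X in (X <= _)%N]mul1n leq_pmul2r // mulnC exprM.
case: k => [|k] /=.
  by rewrite subr0; case: (d ord0) => /=; rewrite ?big_ord0 // big_ord1.
have dk : (d ord0 <= k.+1)%N by apply: leq_trans (leq_b1 _) _.
rewrite dk subSn //.
(* The sums for k + 1 and k differ by the single term s_1 = k + 1 - [d ord0]. *)
by rewrite big_ord_recr /= addrC addrK.
Qed.

Lemma qpoch_recl (A : comNzRingType) (a x : A) n :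
  qpoch a x n.+1 = (1 - a) * qpoch (a * x) x n.
Proof.
rewrite /qpoch big_ord_recl expr0 mulr1; congr (_ * _).
by apply: eq_bigr => i _; rewrite exprS mulrA.
Qed.

(** Induction on n: the factor 1 - Z removes s_1, and the remaining factors are the rescaled product
    for the shorter chain. Rescaling Z^des gives q^(r des), which moves every remaining strict step
    one position to the right in the major index. *)
Lemma dilate_chain_qpoch n (d : 'I_n -> bool) :
  dilate (chain_gf d) * qpoch (fpsX ^+ r) (fpsC q ^+ r) n.+1 =
  (fpsX ^+ r) ^+ (\sum_i d i) * (fpsC q ^+ r) ^+ (\sum_(i < n) i * d i).
Proof.
elim: n => [|n IHn] in d *.
  rewrite !big_ord0 mulr1 /qpoch big_ord1 expr0 mulr1 mulrC.
  apply: fpsP => m; rewrite mulrBl mul1r fps_coefB fps_coefXnM fps_coef1 /=.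
  case: m => [|m]; first by rewrite dvdn0 leqNgt r_gt0 subr0.
  case: leqP => [rm|mr]; first by rewrite dvdn_subl // subrr.
  by rewrite gtnNdvd // subrr.
rewrite qpoch_recl mulrCA mulrA dilate_chain_recl.
set e := fun i => d (lift ord0 i).
have -> : qpoch (fpsX ^+ r * fpsC q ^+ r) (fpsC q ^+ r) n.+1 =
    fps_scale q (qpoch (fpsX ^+ r) (fpsC q ^+ r) n.+1).
  rewrite /qpoch rmorph_prod; apply: eq_bigr => i _.
  rewrite rmorphB rmorph1 rmorphM !rmorphXn /= fps_scaleX fps_scaleC.
  by rewrite exprMn [fpsC q ^+ r * _]mulrC.
rewrite -mulrA -rmorphM IHn rmorphM !rmorphXn /= fps_scaleX fps_scaleC.
rewrite !big_ord_recl mul0n add0n exprMn !exprMn exprD -!mulrA; congr (_ * _).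
rewrite mulrCA; congr (_ * _); rewrite -exprD; congr (_ ^+ _).
by rewrite -big_split; apply: eq_bigr => i _; rewrite /= mulSn.
Qed.

End Chains.

(** Sorting provides one increasing arrangement, and antisymmetry of the reflexive closure makes it
    unique. Hence each f will select exactly one sigma. *)
Lemma sum_sorted_perm (R : pzSemiRingType) n (e : rel 'I_n) :
  irreflexive e -> transitive e -> (forall i j, i != j -> e i j || e j i) ->
  \sum_(s : 'S_n) (sorted e [seq s i | i <- enum 'I_n])%:R = 1 :> R.
Proof.
move=> e_irr e_trans e_total.
pose le : rel 'I_n := fun i j => (i == j) || e i j.
have le_total : total le.
  by move=> i j; rewrite /le; case: eqVneq => //= ij; exact: e_total.
have le_trans : transitive le.
  move=> j i k /predU1P[-> //|eij] /predU1P[<-|ejk]; rewrite /le ?eij ?orbT //.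
  by rewrite (e_trans _ _ _ eij ejk) orbT.
have [s0 Es0] : exists s : 'S_n, sort le (enum 'I_n) = [seq s i | i <- enum 'I_n].
  have /tuple_permP[s Es] : perm_eq (sort le (enum 'I_n)) (ord_tuple n).
    by rewrite perm_sort perm_refl.
  by exists s; rewrite Es; apply: eq_map => i; rewrite tnth_ord_tuple.
(* On lists without repetition the strict and weak orders agree, so results on sorting by [le]
   apply. *)
have lt_sorted t : uniq t -> sorted e t = sorted le t.
  move=> ut; have := sorted_pairwise e_trans t; have := sorted_pairwise le_trans t.
  move=> -> ->; elim: t ut => //= i t IHt /andP[it ut]; rewrite IHt //.
  congr andb; apply: eq_in_all => j jt; rewrite /le; case: eqVneq => // ij.
  by rewrite -ij in jt; rewrite jt in it.
have le_anti : antisymmetric le.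
  move=> i j /andP[/predU1P[//|eij] /predU1P[//|eji]].
  by have := e_trans _ _ _ eij eji; rewrite e_irr.
have uniqP (s : 'S_n) : uniq [seq s i | i <- enum 'I_n].
  by rewrite map_inj_uniq ?enum_uniq //; exact: perm_inj.
rewrite (bigD1 s0) //= lt_sorted // -Es0 sort_sorted // big1 ?addr0 // => s ss0.
case sorted_s: (sorted e _) => //; move: sorted_s; rewrite lt_sorted // => sorted_s; case/eqP: ss0.
have : [seq s i | i <- enum 'I_n] = [seq s0 i | i <- enum 'I_n].
  rewrite -Es0; apply: (sorted_eq le_trans le_anti) => //.
    exact: sort_sorted.
  rewrite perm_sym perm_sort uniq_perm ?enum_uniq // => i.
  rewrite mem_enum; apply/esym/mapP; exists ((s^-1)%g i); rewrite ?mem_enum //.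
  by rewrite permKV.
by move/eq_in_map => E; apply/permP => i; apply: E; rewrite mem_enum.
Qed.

(** * Functions f against pairs of a coloured permutation and a chain *)

Section Coloured.
Variables (r n : nat).

(* Precedence in the list attached to f: larger a first, then smaller letter. *)
Definition sletter_lt K (x y : 'I_K * cletter r n) : bool :=
  (y.1 < x.1)%N || ((x.1 == y.1) && clt x.2 y.2).

Lemma sletter_lt_irr K : irreflexive (@sletter_lt K).
Proof. by move=> x; rewrite /sletter_lt ltnn eqxx clt_irr. Qed.

Lemma sletter_lt_trans K : transitive (@sletter_lt K).
Proof.
move=> y x z /orP[xy|/andP[/eqP xy lxy]] /orP[yz|/andP[/eqP yz lyz]]; apply/orP.
- by left; apply: ltn_trans yz xy.
- by left; rewrite -yz.
- by left; rewrite xy.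
by right; rewrite xy yz eqxx (clt_trans lxy lyz).
Qed.

Lemma sletter_lt_total K (x y : 'I_K * cletter r n) :
  x.2 != y.2 -> sletter_lt x y || sletter_lt y x.
Proof.
move=> /clt_total; rewrite /sletter_lt -!val_eqE /=.
by case: ltngtP => //=; rewrite ?orbT.
Qed.

(** With [clt y.2 x.2] read as the descent flag, precedence of consecutive entries becomes the chain
    inequality. *)
Lemma sletter_ltE K (x y : 'I_K * cletter r n) :
  x.2 != y.2 -> sletter_lt x y = (y.1 + clt y.2 x.2 <= x.1)%N.
Proof.
move=> xy; have := clt_total xy; have := @clt_trans r n x.2 y.2 y.2.
rewrite /sletter_lt -val_eqE clt_irr /=.
by case: (clt x.2 y.2); case: (clt y.2 x.2) => //=; lia.
Qed.

Definition place K (f : 'I_n -> 'I_K * 'I_r) (j : 'I_n) : 'I_K * cletter r n :=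
  ((f j).1, Some (j, (f j).2)).

Lemma path_enum_ord (T : Type) (e : rel T) (t : T) (w : 'I_n -> T) :
  path e t [seq w i | i <- enum 'I_n] =
  [forall i : 'I_n, e (ext t w (widen_ord (leqnSn n) i)) (w i)].
Proof.
have sz : size [seq w i | i <- enum 'I_n] = n by rewrite size_map size_enum_ord.
have nthw (i : 'I_n) : nth t [seq w i | i <- enum 'I_n] i = w i.
  by rewrite (nth_map i) ?size_enum_ord // nth_ord_enum.
have nthx (i : 'I_n) : nth t (t :: [seq w i | i <- enum 'I_n]) i =
    ext t w (widen_ord (leqnSn n) i).
  case: (unliftP ord0 (widen_ord (leqnSn n) i)) => [j ij|i0].
    have -> : nat_of_ord i = j.+1 by have /(congr1 val) := ij; rewrite /= /bump.
    by rewrite ij ext_lift /= nthw.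
  have -> : nat_of_ord i = 0 by have /(congr1 val) := i0.
  by rewrite i0 ext_ord0.
apply/(pathP t)/forallP => [H i|H i]; first by rewrite -nthx -nthw H // sz.
by rewrite sz => lt_in; have := H (Ordinal lt_in); rewrite -nthx -nthw.
Qed.

(** The chain condition says that the placed letters form a path starting from (k, 0). By
    transitivity this splits into sortedness and the condition that every letter follows (k, 0),
    which is r a_j + c_j <= r k. *)
Lemma chain_place k (f : {ffun 'I_n -> 'I_k.+1 * 'I_r}) (s : 'S_n) :
  chain (fun i => i \in DesG ([ffun i => (f (s i)).2], s)) ord_max
        [ffun i => (f (s i)).1] =
  [forall j, (f j).1 < k + ((f j).2 == 0%N :> nat)]%N &&
  sorted (relpre (place f) (@sletter_lt k.+1)) [seq s i | i <- enum 'I_n].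
Proof.
transitivity (path (@sletter_lt k.+1) (ord_max, None)
   [seq place f j | j <- [seq s i | i <- enum 'I_n]]).
  rewrite -map_comp path_enum_ord; apply: eq_forallb => i.
  rewrite sletter_ltE.
    rewrite inE /cval liftK ffunE /= /ext.
    by case: unliftP => [j _|_] /=; rewrite !ffunE.
  (* Consecutive letters differ: the first is the symbol 0, or their indices differ by injectivity
     of sigma. *)
  rewrite /= /ext; case: unliftP => [j ij|//] /=.
  apply/eqP => -[/perm_inj ji _]; move/(congr1 val): ij.
  by rewrite ji /= /bump; lia.
rewrite path_sortedE; last exact: sletter_lt_trans.
rewrite sorted_map; congr andb.
apply/allP/forallP => [H j|H _ /mapP[j _ ->]].
  have /H : place f j \in [seq place f j | j <- [seq s i | i <- enum 'I_n]].
    apply/map_f/mapP; exists ((s^-1)%g j); by rewrite ?mem_enum ?permKV.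
  by rewrite /sletter_lt /= -val_eqE /=; have := ltn_ord (f j).1; lia.
have := H j; rewrite /sletter_lt /= -val_eqE /=.
by have := ltn_ord (f j).1; lia.
Qed.

Variables (R : comNzRingType) (q : R).

(* The pairs (a, c) with r a + c <= r k. *)
Lemma sum_digits k : (0 < r)%N ->
  \sum_(t : 'I_k.+1 * 'I_r | (t.1 < k + (t.2 == 0%N :> nat))%N)
     q ^+ (r * t.1 + t.2) = \sum_(i < (r * k).+1) q ^+ i.
Proof.
move=> r_gt0.
have digits l : \sum_(a < l) \sum_(c < r) q ^+ (r * a + c) = \sum_(i < r * l) q ^+ i.
  elim: l => [|l IHl]; first by rewrite muln0 !big_ord0.
  by rewrite big_ord_recr IHl mulnSr big_split_ord.
rewrite big_mkcond /=.
rewrite -(pair_bigA _ (fun (a : 'I_k.+1) (c : 'I_r) =>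
  if (a < k + (c == 0%N :> nat))%N then q ^+ (r * a + c) else 0)) /=.
(* The top digit a = k is split off; there only c = 0 is allowed, giving the last term q^(r k). *)
rewrite big_ord_recr [RHS]big_ord_recr -digits; congr (_ + _).
  apply: eq_bigr => a _; apply: eq_bigr => c _.
  by rewrite /= ltn_addr.
rewrite (bigD1 (Ordinal r_gt0)) //= addn1 ltnSn addn0 big1 ?addr0 // => c.
by rewrite -val_eqE /= => /negbTE->; rewrite addn0 ltnn.
Qed.

(** Pairs (gamma, s) are reindexed by pairs (f, sigma); for each f exactly one sigma sorts it, and
    the remaining sum over f factors over the n positions. *)
Lemma sum_colperm_chain k : (0 < r)%N ->
  \sum_(g : colperm r n) q ^+ colG g * chain_gf q r (fun i => i \in DesG g) k =
  (\sum_(i < (r * k).+1) q ^+ i) ^+ n.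
Proof.
move=> r_gt0.
pose F (g : colperm r n) (s : {ffun 'I_n -> 'I_k.+1}) : R :=
  if chain (fun i => i \in DesG g) ord_max s
  then q ^+ colG g * (q ^+ r) ^+ (\sum_i s i) else 0.
transitivity (\sum_g \sum_s F g s).
  apply: eq_bigr => g _; rewrite -(chain_gfE q r _ (ord_max : 'I_k.+1)) mulr_sumr.
  by rewrite big_mkcond.
rewrite pair_bigA /=.
pose u (t : 'I_k.+1 * 'I_r) : R :=
  if (t.1 < k + (t.2 == 0%N :> nat))%N then q ^+ (r * t.1 + t.2) else 0.
(* Colours and digits of f are read along sigma; the inverse reads them back along sigma^-1. *)
rewrite (reindex (fun p : {ffun 'I_n -> 'I_k.+1 * 'I_r} * 'S_n =>
  (([ffun i => (p.1 (p.2 i)).2], p.2) : colperm r n, [ffun i => (p.1 (p.2 i)).1])));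
  last first.
  exists (fun gs : colperm r n * {ffun 'I_n -> 'I_k.+1} =>
    ([ffun j => (gs.2 ((gs.1.2^-1)%g j), gs.1.1 ((gs.1.2^-1)%g j))], gs.1.2)).
    move=> [f s] _ /=; congr pair; apply/ffunP => j; rewrite !ffunE permKV.
    by case: (f j).
  move=> [[c s] a] _ /=; congr pair; first congr pair;
    by apply/ffunP => i; rewrite !ffunE /= permK.
transitivity (\sum_(f : {ffun 'I_n -> 'I_k.+1 * 'I_r}) \prod_j u (f j)); last first.
  rewrite -(bigA_distr_bigA (fun _ => u)) /= prodr_const card_ord -sum_digits //.
  by rewrite -big_mkcond.
transitivity (\sum_(f : {ffun 'I_n -> 'I_k.+1 * 'I_r}) \sum_(s : 'S_n)
  \prod_j u (f j) *
  (sorted (relpre (place f) (@sletter_lt k.+1)) [seq s i | i <- enum 'I_n])%:R).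
  rewrite pair_bigA; apply: eq_bigr => -[f s] _; rewrite /F /= chain_place.
  case: forallP => [fk|nfk] /=; last first.
    (* A letter violating the bound contributes a zero factor [u (f j)]. *)
    rewrite [X in X * _](_ : _ = 0) ?mul0r //.
    have /existsP[j nj] : [exists j, ~~ ((f j).1 < k + ((f j).2 == 0 :> nat))%N].
      by rewrite -negb_forall; apply/negP => /forallP.
    by rewrite (bigD1 j) //= /u (negbTE nj) mul0r.
  case: ifP => _; rewrite ?mulr0 // mulr1.
  rewrite -exprM -exprD mulnC.
  under [RHS]eq_bigr => j _ do rewrite /u fk.
  rewrite prodrXr; congr (_ ^+ _).
  rewrite [RHS](reindex_inj (@perm_inj _ s)) big_split addnC mulnC big_distrr /colG /=.
  by congr (_ + _)%N; apply: eq_bigr => i _; rewrite ffunE.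
apply: eq_bigr => f _; rewrite -mulr_sumr sum_sorted_perm ?mulr1 //.
- by move=> j; rewrite /= sletter_lt_irr.
- by move=> j i l; apply: sletter_lt_trans.
by move=> i j ij; apply: sletter_lt_total; apply: contra ij => /eqP[->].
Qed.

End Coloured.


(** * The Carlitz identity for coloured permutations *)

Section Carlitz.
Variables (R : comNzRingType) (q : R) (r n : nat).
Hypothesis r_gt0 : (0 < r)%N.

(** The series splits into one chain series per gamma, and multiplication by the common denominator
    turns each into its monomial Z^des q^fmaj. *)
Lemma dilate_qpoch_Gpoly :
  dilate r (fun k => (\sum_(i < (r * k).+1) q ^+ i) ^+ n) *
    qpoch (fpsX ^+ r) (fpsC q ^+ r) n.+1 =
  Gpoly r n (fpsX ^+ r) (fpsC q).
Proof.
have -> : dilate r (fun k => (\sum_(i < (r * k).+1) q ^+ i) ^+ n) =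
    \sum_(g : colperm r n)
      fpsC (q ^+ colG g) * dilate r (chain_gf q r (fun i => i \in DesG g)).
  apply: fpsP => m; rewrite fps_coef_sum.
  under eq_bigr => g _ do rewrite fps_coefCM.
  rewrite /=; case: ifP => _; last by rewrite big1 // => g _; rewrite mulr0.
  by rewrite -sum_colperm_chain.
rewrite mulr_suml; apply: eq_bigr => g _.
rewrite -mulrA dilate_chain_qpoch // rmorphXn /= mulrCA; congr (_ ^+ _ * _).
  by rewrite /desG -sum1_card [RHS]big_mkcond; apply: eq_bigr => i _; case: ifP.
rewrite -exprM -exprD /fmaj addnC; congr (_ ^+ (r * _ + _)).
rewrite /majG [RHS]big_mkcond.
by apply: eq_bigr => i _; case: ifP => _; rewrite ?muln1 ?muln0.
Qed.

End Carlitz.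

(** As r > 0, each factor has constant term 1. *)
Lemma qpoch_unit (R : comUnitRingType) (x : fps R) r n : (0 < r)%N ->
  qpoch (fpsX ^+ r) x n \is a GRing.unit.
Proof.
move=> r_gt0; apply: rpred_prod => i _.
rewrite fps_unitE fps_coefB fps_coef1 fps_coefXnM leqNgt r_gt0 subr0.
exact: unitr1.
Qed.

(** * Evaluation of the operator at the series z *)

Lemma qvar_neq1 : 1 - qvar != 0.
Proof.
rewrite subr_eq0 /qvar -tofrac1 tofrac_eq eq_sym.
apply/eqP => /(congr1 (fun p : {poly rat} => p`_0)).
by rewrite coefX coef1 => /eqP; rewrite eq_sym oner_eq0.
Qed.

Lemma qintE m : qint m = \sum_(i < m) qvar ^+ i.
Proof.
by apply: (canLR (mulfK qvar_neq1)); rewrite -opprB subrX1 mulrC -mulrN opprB mulrC.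
Qed.

Lemma Fop_fpsX m k : (0 < m)%N -> Fop m fpsX k = (k == m)%:R.
Proof.
(* The coefficients 0 and 1 are written over the denominator 1, so that [substqE] bypasses the
   representative chosen by [repr]. *)
move=> m_gt0; have substq_nat (b : bool) : substq m b%:R = b%:R.
  have b1 : (b%:R : Qq) = FracField.tofrac b%:R / FracField.tofrac 1.
    by rewrite tofrac1 divr1; case: b; rewrite ?tofrac1 ?tofrac0.
  rewrite [in LHS]b1 substqE ?oner_neq0 // comp_polyC tofrac1 divr1.
  by case: b {b1}; rewrite ?comp_polyC ?comp_poly0 ?tofrac1 ?tofrac0.
rewrite /=; case: ifP => [/dvdnP[j ->]|mk].
  by rewrite mulnK // substq_nat -{2}[m]mul1n eqn_pmul2r.
by case: eqVneq mk => // ->; rewrite dvdnn.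
Qed.

Lemma Lq_fpsX (n r : nat) :
  Lq (- n%:Z) 1 r fpsX =
  FPS (fun m => if (1 <= m)%N && (m == 1 %[mod r]) then qint m ^+ n else 0).
Proof.
apply: fpsP => k /=.
transitivity (\sum_(1 <= m < k.+1 | m == 1 %[mod r])
   (if m == k then qint m ^+ n else 0)).
  rewrite big_nat_cond [RHS]big_nat_cond.
  apply: eq_bigr => m /andP[/andP[m_gt0 _] _].
  rewrite [X in _ * X](Fop_fpsX k m_gt0) -invr_expz invrK eq_sym.
  by case: eqP; rewrite ?mulr1 ?mulr0.
case: k => [|k] /=; first by rewrite big_geq.
(* Only the last index m = k contributes to the coefficient of z^k. *)
rewrite big_mkcond big_nat_recr //= eqxx big_nat_cond big1 ?add0r // => m.
by move=> /andP[/andP[_ mk] _]; rewrite (ltn_eqF mk) if_same.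
Qed.

Theorem mainTheorem4 (r n : nat) (hr : (1 <= r)%N) (hn : (1 <= n)%N) :
  let z : fps Qq := fpsX in
  let q : fps Qq := fpsC qvar in
  let L : fps Qq := Lq (- n%:Z) 1 r z in
  L = FPS (fun m => if (1 <= m)%N && (m == 1 %[mod r]) then qint m ^+ n else 0)
  /\ L = z * (Gpoly r n (z ^+ r) q / qpoch (z ^+ r) (q ^+ r) n.+1).
Proof.
move=> z q L; rewrite /L Lq_fpsX; split=> //.
rewrite -dilate_qpoch_Gpoly // mulrK ?qpoch_unit //.
apply: fpsP => -[|m]; rewrite fps_coefXM //=.
(* The exponent m + 1 is 1 modulo r exactly when r divides m, and then it equals r (m / r) + 1. *)
rewrite eqn_mod_dvd // subn1 /=; case: ifP => // rm.
by rewrite qintE [(r * _)%N]mulnC divnK.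
Qed.
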